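(* Let $m,k,n$ be integers with $k\in\{1,\dots,m-2\}$ and $n\ge 6$. Consider participatory budgeting with approval ballots, with $n$ citizens and a set $A$ of $m$ projects, whose costs and whose budget are such that every set of $k$ projects is within the budget and every set of more than $k$ projects exceeds the budget (for instance, all projects have the same cost $c>0$ and the budget $B$ satisfies $kc\le B<(k+1)c$). Then there is no maximal mechanism that is both unanimous and strongly group-strategyproof.
   Context: Each project $a\in A$ has a known positive cost, and a set of projects is feasible if its total cost is at most the budget. Each citizen $i\in N$ (with $|N|=n$) casts an approval ballot $P_i\subseteq A$, which may be an arbitrary set of projects (even one whose total cost exceeds the budget). A mechanism is a (deterministic) function $M$ assigning to every profile $P=(P_i)_{i\in N}$ a feasible set of projects $M(P)$. It is maximal if it always returns a maximally feasible set, i.e. adding any other project violates the budget constraint. Each citizen aims to have as many of her approved projects selected as possible: citizen $i$ with preference $P_i$ evaluates an outcome $C$ by $|C\cap P_i|$, larger being better (for outcomes of a fixed size $k$ this is equivalent to preferring a smaller Hamming distance $|C\setminus P_i|+|P_i\setminus C|$). $M$ is strongly group-strategyproof if for every profile $P$ and every coalition $S\subseteq N$ there is no profile $P'_S$ of ballots of the citizens in $S$ such that $|M(P'_S,P_{-S})\cap P_i|\ge |M(P)\cap P_i|$ for every $i\in S$, with strict inequality for at least one $i\in S$. Here $P_{-S}$ denotes the ballots in $P$ of the citizens not in $S$. $M$ is unanimous if, for every set $C$ of exactly $k$ projects, whenever all citizens submit the ballot $C$ the mechanism outputs $C$. *)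

(* Defs.v *)
From HB Require Import structures.
From mathcomp Require Import all_boot all_order all_algebra.

Set Implicit Arguments.
Unset Strict Implicit.
Unset Printing Implicit Defensive.

Import Order.TTheory GRing.Theory Num.Theory.

Definition total_cost (R : realFieldType) (A : finType) (cost : A -> R)
    (C : {set A}) : R :=
  (\sum_(a in C) cost a)%R.

Definition feasible (R : realFieldType) (A : finType) (cost : A -> R) (B : R)
    (C : {set A}) : bool :=
  (total_cost cost C <= B)%R.

Definition maximally_feasible (R : realFieldType) (A : finType)
    (cost : A -> R) (B : R) (C : {set A}) : Prop :=
  feasible cost B C /\
  forall a : A, a \notin C -> ~~ feasible cost B (a |: C).

(* A ballot is an arbitrary set of projects, not necessarily feasible. *)
Definition profile (N A : finType) : Type := {ffun N -> {set A}}.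

Record mechanism (R : realFieldType) (N A : finType) (cost : A -> R) (B : R) :
    Type := Mechanism {
  outcome :> profile N A -> {set A};
  outcome_feasible : forall P : profile N A, feasible cost B (outcome P)
}.

Definition maximal (R : realFieldType) (N A : finType) (cost : A -> R) (B : R)
    (M : mechanism N cost B) : Prop :=
  forall P : profile N A, maximally_feasible cost B (M P).

Definition unanimous (R : realFieldType) (N A : finType) (cost : A -> R)
    (B : R) (k : nat) (M : mechanism N cost B) : Prop :=
  forall C : {set A}, #|C| = k -> M [ffun=> C] = C.

(* The profile (P'_S, P_{-S}); the values of P' outside S are irrelevant. *)
Definition deviation (N A : finType) (S : {set N}) (P' P : profile N A) :
    profile N A :=
  [ffun i => if i \in S then P' i else P i].

Definition strongly_group_strategyproof (R : realFieldType) (N A : finType)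
    (cost : A -> R) (B : R) (M : mechanism N cost B) : Prop :=
  forall (P : profile N A) (S : {set N}),
  ~ exists P' : profile N A,
      (forall i, i \in S ->
         #|M P :&: P i| <= #|M (deviation S P' P) :&: P i|) /\
      (exists2 i, i \in S &
         #|M P :&: P i| < #|M (deviation S P' P) :&: P i|).

(* Main.v *)
Require Import Defs.
From mathcomp Require Import all_boot all_order all_algebra zify.

Set Implicit Arguments.
Unset Strict Implicit.
Unset Printing Implicit Defensive.

(** Fix a set X of k - 1 projects and let every citizen approve X plus a set y v
    of other projects.  Efficiency (unanimity plus strategyproofness) makes the
    outcome X plus a single winner g y, so g is a rule electing one project.
    Only three voters matter; the others approve nothing outside X.
    Write i beats j for (a, b) if a wins when i approves a, j approves b and l
    approves nothing.  As l is indifferent, b then never wins, whatever l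
    reports; hence whether a wins depends on the pair (a, b) only, not on the
    voters.  So g induces a tournament on projects, and any three of them form a
    chain a -> b -> c.  With ballots {a, c}, {b}, {c} the winner must be b, and
    the first voter gains by reporting {a}, a contradiction. *)

(** * General consequences of the axioms, and the single-winner setting *)

(** The coalition is everybody who does not lose. It contains all voters who change their ballot, so
    it can enforce [P'], and it contains any voter who strictly gains. *)
Lemma strategyproof_outcome_le (R : realFieldType) (N A : finType)
    (cost : A -> R) (B : R) (M : mechanism N cost B) (P P' : profile N A) :
  strongly_group_strategyproof M ->
  (forall v, P' v = P v \/ #|M P :&: P v| <= #|M P' :&: P v|) ->
  forall v, #|M P' :&: P v| <= #|M P :&: P v|.
Proof.
move=> sgsp weak v; rewrite leqNgt; apply/negP => gain.
pose S := [set v | #|M P :&: P v| <= #|M P' :&: P v|].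
apply: (sgsp P S); exists P'.
have -> : deviation S P' P = P'.
  apply/ffunP => i; rewrite ffunE inE; case: ifP => // iS.
  by case: (weak i); rewrite ?iS.
split=> [i|]; first by rewrite inE.
by exists v; rewrite ?inE // ltnW.
Qed.

(** By unanimity all voters together can enforce [C]. *)
Lemma strategyproof_efficient (R : realFieldType) (N A : finType)
    (cost : A -> R) (B : R) (k : nat) (M : mechanism N cost B)
    (P : profile N A) (C : {set A}) :
  unanimous k M -> strongly_group_strategyproof M -> #|C| = k ->
  (forall v, #|M P :&: P v| <= #|C :&: P v|) ->
  forall v, #|C :&: P v| <= #|M P :&: P v|.
Proof.
move=> unan sgsp cardC le_C v; have MC := unan C cardC.
have := @strategyproof_outcome_le _ _ _ _ _ _ P [ffun=> C] sgsp.
by rewrite MC; apply=> i; right.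
Qed.

Lemma card_maximally_feasible (R : realFieldType) (A : finType)
    (cost : A -> R) (B : R) (k : nat) (C : {set A}) :
  k <= #|A| -> (forall a, (0 < cost a)%R) ->
  (forall D : {set A}, #|D| = k -> feasible cost B D) ->
  (forall D : {set A}, k < #|D| -> ~~ feasible cost B D) ->
  maximally_feasible cost B C -> #|C| = k.
Proof.
move=> k_le cost_gt0 k_feas gtk_infeas [feasC maxC].
apply/eqP; rewrite eqn_leq; apply/andP; split.
  by rewrite leqNgt; apply/negP => /gtk_infeas; rewrite feasC.
rewrite leqNgt; apply/negP => ltCk.
have [s /andP[s_uniq /eqP s_size] sub_s] :
    exists2 s : seq A, uniq s && (size s == k) & {subset C <= s}.
  (* Listing [C] first makes the first [k] projects a superset of [C]. *)
  exists (take k (enum C ++ enum (~: C))).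
    rewrite take_uniq ?size_takel ?eqxx //.
      by rewrite size_cat -!cardE cardsC.
    rewrite cat_uniq !enum_uniq andbT; apply/hasPn => x.
    by rewrite !mem_enum !inE.
  by move=> x xC; rewrite take_cat -cardE ltnNge (ltnW ltCk) /= mem_cat mem_enum xC.
have cardD : #|[set x in s]| = k by rewrite cardsE (card_uniqP s_uniq).
have /subsetPn[a aD aC] : ~~ ([set x in s] \subset C).
  by apply/negP => /subset_leq_card; rewrite cardD leqNgt ltCk.
(* Costs are positive, so adding [a] to [C] costs no more than the feasible [k]-set. *)
have /negP[] := maxC a aC; have := k_feas _ cardD.
apply: Order.POrderTheory.le_trans; rewrite /total_cost.
have sub : a |: C \subset [set x in s].
  apply/subsetP => x; rewrite !inE => /orP[/eqP->|/sub_s //].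
  by move: aD; rewrite inE.
rewrite [leRHS](big_setID (a |: C)) /= (setIidPr sub).
rewrite Num.Theory.lerDl Num.Theory.sumr_ge0 // => x _.
exact: Order.POrderTheory.ltW.
Qed.

(* With two distinct singleton ballots among the y v, no project outside X is
   approved by everybody, so efficiency forces all of X to be selected; W will
   be the complement of X. *)
Definition conflicting (N A : finType) (W : {set A}) (y : profile N A) : Prop :=
  (forall v, y v \subset W) /\
  exists i j a b, [/\ a != b, y i = [set a] & y j = [set b]].

(** Pareto efficiency for approval of one winner, required only where the outcome is known to be [X]
    plus one project. *)
Definition single_winner_efficient (N A : finType) (W : {set A})
    (g : profile N A -> A) : Prop :=
  forall y w, conflicting W y -> w \in W ->
  (forall v, g y \in y v -> w \in y v) -> forall v, w \in y v -> g y \in y v.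

Definition single_winner_sgsp (N A : finType) (W : {set A})
    (g : profile N A -> A) : Prop :=
  forall y y', conflicting W y -> conflicting W y' ->
  (forall v, y' v = y v \/ (g y \in y v -> g y' \in y v)) ->
  forall v, g y' \in y v -> g y \in y v.

Definition profile3 (N A : finType) (i j l : N) (Y1 Y2 Y3 : {set A}) :
    profile N A :=
  [ffun v => if v == i then Y1 else if v == j then Y2
             else if v == l then Y3 else set0].

Lemma profile3_swap12 (N A : finType) (i j l : N) (Y1 Y2 Y3 : {set A}) :
  i != j -> profile3 i j l Y1 Y2 Y3 = profile3 j i l Y2 Y1 Y3.
Proof.
move=> ij; apply/ffunP => v; rewrite !ffunE.
by case: eqVneq => // ->; rewrite (negPf ij).
Qed.

Lemma profile3_swap23 (N A : finType) (i j l : N) (Y1 Y2 Y3 : {set A}) :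
  j != l -> profile3 i j l Y1 Y2 Y3 = profile3 i l j Y1 Y3 Y2.
Proof.
move=> jl; apply/ffunP => v; rewrite !ffunE; case: (v == i) => //.
by case: eqVneq => // ->; rewrite (negPf jl).
Qed.

(** * Electing one project with three active voters *)

Section ThreeVoters.
Context (N A : finType) (W : {set A}) (g : profile N A -> A).
Hypothesis eff : single_winner_efficient W g.
Hypothesis sgsp : single_winner_sgsp W g.

Lemma conflicting_profile3 (i j l : N) (a b : A) (Y : {set A}) :
  i != j -> a != b -> a \in W -> b \in W -> Y \subset W ->
  conflicting W (profile3 i j l [set a] [set b] Y).
Proof.
move=> ij ab aW bW YW; split=> [v|].
  by rewrite ffunE; do 3?case: eqP => _; rewrite ?sub1set ?sub0set.
by exists i, j, a, b; split; rewrite // ffunE ?eqxx // eq_sym (negPf ij).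
Qed.

Lemma sgsp_profile3 (i j l : N) (Y1 Y2 Y3 Z1 Z2 Z3 : {set A}) :
  uniq [:: i; j; l] ->
  let y := profile3 i j l Y1 Y2 Y3 in let z := profile3 i j l Z1 Z2 Z3 in
  conflicting W y -> conflicting W z ->
  Z1 = Y1 \/ (g y \in Y1 -> g z \in Y1) ->
  Z2 = Y2 \/ (g y \in Y2 -> g z \in Y2) ->
  Z3 = Y3 \/ (g y \in Y3 -> g z \in Y3) ->
  [/\ g z \in Y1 -> g y \in Y1, g z \in Y2 -> g y \in Y2
    & g z \in Y3 -> g y \in Y3].
Proof.
rewrite /= !inE negb_or andbT => /andP[/andP[ij il] jl] cy cz d1 d2 d3.
have weak v : profile3 i j l Z1 Z2 Z3 v = profile3 i j l Y1 Y2 Y3 v \/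
    (g (profile3 i j l Y1 Y2 Y3) \in profile3 i j l Y1 Y2 Y3 v ->
     g (profile3 i j l Z1 Z2 Z3) \in profile3 i j l Y1 Y2 Y3 v).
  rewrite [in LHS]ffunE [profile3 _ _ _ _ _ _ v]ffunE.
  by do 3?case: ifP => _ //; left.
have le := sgsp cy cz weak.
split; [move: (le i) | move: (le j) | move: (le l)];
  rewrite [profile3 _ _ _ _ _ _ _]ffunE ?eqxx //.
  by rewrite eq_sym (negPf ij).
by rewrite eq_sym (negPf il) eq_sym (negPf jl).
Qed.

(** A winner approved by nobody would be dominated by [a], which [i] approves. *)
Lemma single_winner_approved (i j l : N) (a b : A) (Y : {set A}) :
  i != j -> a != b -> a \in W -> b \in W -> Y \subset W ->
  g (profile3 i j l [set a] [set b] Y) \in a |: (b |: Y).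
Proof.
move=> ij ab aW bW YW; set y := profile3 _ _ _ _ _ _.
have cy := conflicting_profile3 l ij ab aW bW YW.
apply/negPn/negP; rewrite !inE !negb_or => /and3P[ga gb gY].
have yi : y i = [set a] by rewrite ffunE eqxx.
suff : g y \in y i by rewrite yi inE (negPf ga).
apply: (eff cy aW); last by rewrite yi set11.
move=> v; have : g y \notin y v; last by move/negPf->.
rewrite /y ffunE -/y.
by do 3?case: ifP => _; rewrite ?inE.
Qed.

Definition beats (i j l : N) (a b : A) : Prop :=
  g (profile3 i j l [set a] [set b] set0) = a.

(* The voter l with the empty ballot is indifferent, so it could join j in a
   deviation making b win. *)
Lemma beats_any (i j l : N) (a b : A) (Y : {set A}) :
  uniq [:: i; j; l] -> a != b -> a \in W -> b \in W -> Y \subset W ->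
  beats i j l a b -> g (profile3 i j l [set a] [set b] Y) != b.
Proof.
move=> u ab aW bW YW bt; apply/eqP => gb.
have ij : i != j by move: u; rewrite /= !inE negb_or; case/andP=> /andP[].
have [|||||_ + _] := sgsp_profile3 (Y1 := [set a]) (Y2 := [set b]) (Y3 := set0)
   (Z1 := [set a]) (Z2 := [set b]) (Z3 := Y) u; try by [left | right; rewrite inE].
- by apply: conflicting_profile3; rewrite ?sub0set.
- exact: conflicting_profile3.
by rewrite gb bt !inE eqxx (negPf ab) => /(_ isT).
Qed.

Lemma beats_total (i j l : N) (a b : A) :
  uniq [:: i; j; l] -> a != b -> a \in W -> b \in W ->
  beats i j l a b \/ beats j i l b a.
Proof.
move=> u ab aW bW.
have ij : i != j by move: u; rewrite /= !inE negb_or; case/andP=> /andP[].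
have := single_winner_approved l ij ab aW bW (sub0set W).
rewrite /beats -(profile3_swap12 _ _ _ _ ij).
by rewrite !inE orbF => /orP[] /eqP; [left|right].
Qed.

(** If [j] and [l] both report [b], then [a] still wins by [beats_any]. When only [l] reports [b],
    the indifferent [j] can bring this about, to the benefit of [i] unless [a] wins already. *)
Lemma beats_swap23 (i j l : N) (a b : A) :
  uniq [:: i; j; l] -> a != b -> a \in W -> b \in W ->
  beats i j l a b -> beats i l j a b.
Proof.
move=> u ab aW bW bt; have ba : b != a by rewrite eq_sym.
have [ij il jl] : [/\ i != j, i != l & j != l].
  by move: u; rewrite /= !inE negb_or andbT => /andP[/andP[]].
have u' : uniq [:: i; l; j] by rewrite /= !inE negb_or ij il eq_sym jl.
have bW1 : [set b] \subset W by rewrite sub1set.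
have gz : g (profile3 i l j [set a] [set b] [set b]) = a.
  rewrite (profile3_swap23 _ _ _ _ (j := l)) 1?eq_sym //.
  have := single_winner_approved l ij ab aW bW bW1.
  have := beats_any u ab aW bW bW1 bt.
  by rewrite !inE orbb => /negPf->; rewrite orbF => /eqP.
have [|||||+ _ _] := sgsp_profile3 (Y1 := [set a]) (Y2 := [set b]) (Y3 := set0)
   (Z1 := [set a]) (Z2 := [set b]) (Z3 := [set b]) u';
   try by [left | right; rewrite inE].
- by apply: conflicting_profile3; rewrite ?sub0set.
- exact: conflicting_profile3.
by rewrite gz !inE eqxx => /(_ isT)/eqP.
Qed.

(** Otherwise [j] with [b] beats [l] with [a]. On the ballots [a], [b], [a] of [i], [j], [l],
    [beats_any] then excludes both [a] and [b]. *)
Lemma beats_swap13 (i j l : N) (a b : A) :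
  uniq [:: i; j; l] -> a != b -> a \in W -> b \in W ->
  beats i j l a b -> beats l j i a b.
Proof.
move=> u ab aW bW bt; have ba : b != a by rewrite eq_sym.
have [ij il jl] : [/\ i != j, i != l & j != l].
  by move: u; rewrite /= !inE negb_or andbT => /andP[/andP[]].
have aW1 : [set a] \subset W by rewrite sub1set.
have ulji : uniq [:: l; j; i].
  by rewrite /= !inE negb_or [l == j]eq_sym jl [l == i]eq_sym il eq_sym ij.
have ujli : uniq [:: j; l; i].
  by rewrite /= !inE negb_or jl [j == i]eq_sym ij eq_sym il.
case: (beats_total ulji ab aW bW) => // bt'; exfalso.
have := beats_any ujli ba bW aW aW1 bt'.
have := beats_any u ab aW bW aW1 bt.
have := single_winner_approved l ij ab aW bW aW1.
rewrite (profile3_swap12 _ _ _ _ ij) (profile3_swap23 _ _ _ _ il).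
by rewrite !inE => /or3P[]/eqP->; rewrite eqxx.
Qed.

Lemma beats_chain_false (i j l : N) (a b c : A) :
  uniq [:: i; j; l] -> a != b -> b != c -> a != c ->
  a \in W -> b \in W -> c \in W ->
  beats i j l a b -> beats i j l b c -> False.
Proof.
move=> u ab bc ac aW bW cW bt_ab bt_bc.
have [ij il jl] : [/\ i != j, i != l & j != l].
  by move: u; rewrite /= !inE negb_or andbT => /andP[/andP[]].
have uilj : uniq [:: i; l; j] by rewrite /= !inE negb_or ij il eq_sym jl.
have ujli : uniq [:: j; l; i].
  by rewrite /= !inE negb_or jl [j == i]eq_sym ij eq_sym il.
(* Voters are permuted so that [j] defends [b] in both comparisons: against [a] of [i] and against
   [c] of [l]. *)
have {}bt_bc : beats j l i b c by apply: beats_swap13 => //; apply: beats_swap23.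
have acW : [set a; c] \subset W by rewrite subUset !sub1set aW.
have aW1 : [set a] \subset W by rewrite sub1set.
have cW1 : [set c] \subset W by rewrite sub1set.
pose y := profile3 j l i [set b] [set c] [set a; c].
have cy : conflicting W y by apply: conflicting_profile3.
(* [c] loses to [b]; and [a] is dominated by [c], which has every approval of [a] and also that of
   [l]. *)
have gy : g y = b.
  have := single_winner_approved i jl bc bW cW acW; rewrite -/y.
  have := beats_any ujli bc bW cW acW bt_bc; rewrite -/y.
  rewrite !inE => /negPf->; rewrite orbF => /orP[/eqP //|/eqP gya].
  have yl : y l = [set c] by rewrite ffunE eq_sym (negPf jl) eqxx.
  have : g y \in y l.
    apply: (eff cy cW); last by rewrite yl set11.
    move=> v; rewrite gya ffunE.
    by do 3?case: ifP => _; rewrite !inE ?(negPf ab) ?(negPf ac) ?eqxx ?orbT.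
  by rewrite yl gya inE (negPf ac).
(* Once [i] reports only [a], [b] cannot win, so the winner is in the true ballot of [i]. *)
have gz : g (profile3 j l i [set b] [set c] [set a]) \in [set a; c].
  have := single_winner_approved l ij ab aW bW cW1.
  have := beats_any u ab aW bW cW1 bt_ab.
  rewrite (profile3_swap12 _ _ _ _ ij) (profile3_swap23 _ _ _ _ il).
  by rewrite !inE => /negPf->.
have [||||_ _ /(_ gz)] := sgsp_profile3 (Y1 := [set b]) (Y2 := [set c])
   (Y3 := [set a; c]) (Z1 := [set b]) (Z2 := [set c]) (Z3 := [set a]) ujli cy;
   try by left.
- exact: conflicting_profile3.
- by right.
by rewrite -/y gy !inE eq_sym (negPf ab) (negPf bc).
Qed.

(** Each of the eight orientations of a triangle contains a directed path through all three
    vertices. *)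
Lemma no_single_winner_rule (i j l : N) (a b c : A) :
  uniq [:: i; j; l] -> uniq [:: a; b; c] ->
  a \in W -> b \in W -> c \in W -> False.
Proof.
move=> u; rewrite /= !inE negb_or andbT => /andP[/andP[ab ac] bc] aW bW cW.
have [ij il jl] : [/\ i != j, i != l & j != l].
  by move: u; rewrite /= !inE negb_or andbT => /andP[/andP[]].
have ujil : uniq [:: j; i; l] by rewrite /= !inE negb_or eq_sym ij jl il.
have ujli : uniq [:: j; l; i].
  by rewrite /= !inE negb_or jl [j == i]eq_sym ij eq_sym il.
have uilj : uniq [:: i; l; j] by rewrite /= !inE negb_or ij il eq_sym jl.
have total x z : x != z -> x \in W -> z \in W ->
    beats i j l x z \/ beats i j l z x.
  move=> xz xW zW; have zx : z != x by rewrite eq_sym.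
  case: (beats_total u xz xW zW) => [|bt]; [by left|right].
  (* Three swaps compose to the transposition of the first two voters. *)
  by apply: beats_swap23 => //; apply: beats_swap13 => //; apply: beats_swap23.
have chain x z t := @beats_chain_false i j l x z t u.
have [ba ca cb] : [/\ b != a, c != a & c != b] by rewrite !(eq_sym _ a) (eq_sym c).
case: (total a b ab aW bW) (total b c bc bW cW) (total a c ac aW cW)
  => ? [] ? [] ?.
- by apply: (chain a b c).
- by apply: (chain a b c).
- by apply: (chain a c b).
- by apply: (chain c a b).
- by apply: (chain b a c).
- by apply: (chain b c a).
- by apply: (chain b a c).
- by apply: (chain c b a).
Qed.

End ThreeVoters.

(** * Reduction of the mechanism to a single-winner rule *)

Lemma card_extend_common (A : finType) (X Y : {set A}) (w : A) :
  w \notin X -> #|(w |: X) :&: (X :|: Y)| = #|X| + (w \in Y).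
Proof.
move=> wX; have [wY|wY] := boolP (w \in Y).
  suff -> : (w |: X) :&: (X :|: Y) = w |: X by rewrite cardsU1 wX addnC.
  apply/setIidPl/subsetP => x; rewrite !inE => /orP[/eqP->|->] //.
  by rewrite wY orbT.
suff -> : (w |: X) :&: (X :|: Y) = X by rewrite addn0.
apply/setP => x; rewrite !inE; case: eqVneq => [->|_] /=.
  by rewrite (negPf wX) (negPf wY).
by case: (x \in X).
Qed.

Definition add_common (N A : finType) (X : {set A}) (y : profile N A) :
  profile N A := [ffun v => X :|: y v].

(** If some [x] in [X] were left out, exchanging a selected [z] outside [X] for [x] would harm
    nobody. By efficiency nobody gains either, so everybody approves [z], against the two distinct
    singleton ballots. *)
Lemma outcome_add_common (R : realFieldType) (N A : finType)
    (cost : A -> R) (B : R) (k : nat) (M : mechanism N cost B)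
    (X : {set A}) (y : profile N A) :
  (forall P, #|M P| = k) -> unanimous k M -> strongly_group_strategyproof M ->
  #|X|.+1 = k -> conflicting (~: X) y ->
  exists2 w, w \notin X & M (add_common X y) = w |: X.
Proof.
move=> cardM unan sgsp cardX [sub [i [j [a [b [ab yi yj]]]]]].
set P := add_common X y; have cardC := cardM P.
have subX : X \subset M P.
  apply/negPn/negP => /subsetPn[x xX xM].
  have /subsetPn[z zM zX] : ~~ (M P \subset X).
    by apply/negP => /subset_leq_card; rewrite cardC -cardX ltnn.
  pose C := x |: (M P :\ z).
  have cardC' : #|C| = k.
    by rewrite cardsU1 !inE (negPf xM) andbF -cardC (cardsD1 z (M P)) zM.
  have CP v : #|C :&: P v| = (#|(M P :&: P v) :\ z|).+1.
    have -> : C :&: P v = x |: ((M P :&: P v) :\ z).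
      rewrite ffunE; apply/setP => t; rewrite !inE.
      by case: eqVneq => [->|_] /=; rewrite ?xX // andbA.
    by rewrite cardsU1 !inE (negPf xM) /= andbF.
  have le v : #|M P :&: P v| <= #|C :&: P v|.
    by rewrite CP (cardsD1 z (M P :&: P v)) -add1n leq_add2r leq_b1.
  have zy v : z \in y v.
    have := strategyproof_efficient unan sgsp cardC' le v.
    rewrite CP (cardsD1 z (M P :&: P v)) -add1n leq_add2r lt0b.
    by rewrite !inE ffunE !inE (negPf zX) => /andP[].
  move: (zy i) (zy j); rewrite yi yj !inE => /eqP-> /eqP ba.
  by rewrite ba eqxx in ab.
have /cards1P[w defw] : #|M P :\: X| == 1.
  by rewrite cardsD (setIidPr subX) cardC -cardX subSnn.
exists w; first by have := set11 w; rewrite -defw inE => /andP[].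
by rewrite -defw -[LHS](setID _ X) (setIidPr subX) setUC.
Qed.

Lemma single_winner_reduction (R : realFieldType) (N A : finType)
    (cost : A -> R) (B : R) (k : nat) (M : mechanism N cost B) (X : {set A}) :
  (forall P, #|M P| = k) -> unanimous k M -> strongly_group_strategyproof M ->
  #|X|.+1 = k ->
  exists g : profile N A -> A,
    single_winner_efficient (~: X) g /\ single_winner_sgsp (~: X) g.
Proof.
move=> cardM unan sgsp cardX.
have [x0 _] : exists x0, x0 \notin X.
  apply/existsP; rewrite -negb_forall; apply/negP => /forallP full.
  have : M [ffun=> X] \subset X by apply/subsetP => x _; apply: full.
  by move/subset_leq_card; rewrite cardM -cardX ltnn.
(* On conflicting profiles the picked project is the only one selected outside [X]; [x0] merely
   makes [g] total. *)
pose g (y : profile N A) := odflt x0 [pick w in M (add_common X y) :\: X].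
have gP y : conflicting (~: X) y ->
    g y \notin X /\ M (add_common X y) = g y |: X.
  move=> /(outcome_add_common cardM unan sgsp cardX)[w wX Mw].
  suff -> : g y = w by [].
  rewrite /g; case: pickP => [t|/(_ w)]; rewrite Mw !inE ?eqxx ?wX //.
  by case: (t \in X); rewrite //= orbF => /eqP.
have card_g y v : conflicting (~: X) y ->
    #|M (add_common X y) :&: add_common X y v| = #|X| + (g y \in y v).
  by move=> /gP[gX ->]; rewrite ffunE card_extend_common.
exists g; split=> [y w cy | y y' cy cy'].
  rewrite inE => wX le v wy.
  have cardw : #|w |: X| = k by rewrite cardsU1 wX.
  have := strategyproof_efficient (P := add_common X y) unan sgsp cardw.
  have cw u : #|(w |: X) :&: add_common X y u| = #|X| + (w \in y u).
    by rewrite ffunE card_extend_common.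
  move/(_ _ v); rewrite card_g // cw leq_add2l wy lt0b; apply=> u.
  rewrite card_g // cw leq_add2l.
  by case: (g y \in y u) (le u) => // ->.
move=> weak v gy'.
have cg u : #|M (add_common X y') :&: add_common X y u| = #|X| + (g y' \in y u).
  by have [gX ->] := gP _ cy'; rewrite ffunE card_extend_common.
have := strategyproof_outcome_le (P := add_common X y) (P' := add_common X y') sgsp.
move/(_ _ v); rewrite cg card_g // leq_add2l gy' lt0b; apply=> u.
case: (weak u) => [eq_u|gu]; [left|right]; first by rewrite !ffunE eq_u.
by rewrite cg card_g // leq_add2l; case: (g y \in y u) gu => // ->.
Qed.


Theorem theorem9 (m k n : nat) (hk1 : 1 <= k) (hk2 : k + 2 <= m) (hn : 6 <= n)
    (R : realFieldType) (N A : finType) (hN : #|N| = n) (hA : #|A| = m)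
    (cost : A -> R) (B : R) (cost_gt0 : forall a : A, (0 < cost a)%R)
    (k_feasible : forall C : {set A}, #|C| = k -> feasible cost B C)
    (gtk_infeasible : forall C : {set A}, k < #|C| -> ~~ feasible cost B C) :
  ~ exists M : mechanism N cost B,
      [/\ maximal M, unanimous k M & strongly_group_strategyproof M].
Proof.
move=> [M [maxM unan sgsp]].
have k_le : k <= #|A| by rewrite hA (leq_trans _ hk2) // leq_addr.
have cardM P : #|M P| = k.
  exact: card_maximally_feasible k_le cost_gt0 k_feasible gtk_infeasible (maxM P).
have [X cardX] : exists X : {set A}, #|X| = k.-1.
  exists [set x in take k.-1 (enum A)].
  rewrite cardsE (card_uniqP (take_uniq _ (enum_uniq A))) size_takel //.
  by rewrite -cardE (leq_trans (leq_pred k)).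
(* The complement of [X] has [m - k + 1] projects, at least three because [k + 2 <= m]. *)
have [a [b [c [[aX bX cX] [ab bc ca]]]]] :
    exists a b c, [/\ a \in ~: X, b \in ~: X & c \in ~: X] /\
                  [/\ a != b, b != c & c != a].
  by apply/card_gt2P; rewrite cardsCs setCK cardX hA; lia.
have [i [j [l [_ [ij jl li]]]]] :
    exists i j l, [/\ i \in [set: N], j \in [set: N] & l \in [set: N]] /\
                  [/\ i != j, j != l & l != i].
  by apply/card_gt2P; rewrite cardsT hN (leq_trans _ hn).
have cardX1 : #|X|.+1 = k by rewrite cardX prednK.
have [g [eff gsp]] := single_winner_reduction cardM unan sgsp cardX1.
by apply: (no_single_winner_rule eff gsp (i := i) (j := j) (l := l)
  (a := a) (b := b) (c := c)); rewrite //= !inE negb_or andbT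
  ?ij ?jl ?ab ?bc /= ?andbT eq_sym.
Qed.
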